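(* Let $(S,\pi)$ be a proper simplex bundle and $\sigma$ a simple flow such that $(S,\pi)$ is isomorphic to the KMS bundle $(S^\sigma,\pi^\sigma)$ of $\sigma$. If $\pi(S)$ contains an interval of the form $[r,\infty)$, then $\mathrm{KMS}_\infty(\sigma)$ is a connected compact metric space.
   Context: A flow $\sigma=(\sigma_t)_{t\in\mathbb R}$ on a $C^*$-algebra $A$ is a strongly (pointwise norm) continuous one-parameter group of $*$-automorphisms. A simple flow is a flow $\sigma$ on a unital separable $C^*$-algebra $A$ which is non-trivial (not $\sigma_t=\mathrm{id}_A$ for all $t$) and such that the only closed two-sided $\sigma$-invariant ideals of $A$ are $\{0\}$ and $A$. $\mathcal A_\sigma$ is the dense $*$-algebra of elements $a$ analytic for $\sigma$ ($t\mapsto\sigma_t(a)$ extends to an entire function $z\mapsto\sigma_z(a)$). For $\beta\in\mathbb R$, a state $\omega$ is a $\beta$-KMS state if it is $\sigma$-invariant and $\omega(ab)=\omega(b\sigma_{i\beta}(a))$ for all $b\in A$, $a\in\mathcal A_\sigma$; $S^\sigma_\beta$ is the (possibly empty) simplex of $\beta$-KMS states. $\mathrm{KMS}_\infty(\sigma):=\bigcap_{R>0}\overline{\bigcup_{\beta\ge R}S^\sigma_\beta}$ (weak* closures in the state space), with the weak* topology. Simplex bundles: Let $S$ be a second countable locally compact Hausdorff space and $\pi:S\to\mathbb R$ continuous (not necessarily surjective). $(S,\pi)$ is a simplex bundle if each fibre $\pi^{-1}(t)$ with the relative topology is homeomorphic to a compact Choquet simplex (and is regarded as such, with its affine structure;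 the empty set is allowed). $\mathcal A(S,\pi)$ is the set of continuous $f:S\to\mathbb R$ affine on each fibre. $(S,\pi)$ is proper if $\pi^{-1}(K)$ is compact for every compact $K\subseteq\mathbb R$ and $\mathcal A(S,\pi)$ separates points of $S$. An isomorphism of proper simplex bundles $(S,\pi)\to(S',\pi')$ is a homeomorphism $\phi:S\to S'$ with $\pi'\circ\phi=\pi$ that is affine on each fibre. The KMS bundle of $\sigma$ is $(S^\sigma,\pi^\sigma)$ with $S^\sigma=\{(\omega,\beta)\in E(A)\times\mathbb R:\omega\in S^\sigma_\beta\}$ ($E(A)$ the state space with the weak* topology; $S^\sigma$ has the topology inherited from the product) and $\pi^\sigma(\omega,\beta)=\beta$. *)

(* Defs.v *)
From HB Require Import structures.
From mathcomp Require Import all_boot all_order all_algebra.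
From mathcomp Require Import complex.
From mathcomp Require Import all_classical all_reals all_analysis.

Set Implicit Arguments.
Unset Strict Implicit.
Unset Printing Implicit Defensive.

Import Order.TTheory GRing.Theory Num.Theory.
Import numFieldNormedType.Exports.

Local Open Scope classical_set_scope.
Local Open Scope ring_scope.
Local Open Scope complex_scope.

Definition homeomorphism (X Y : topologicalType) (f : X -> Y) : Prop :=
  continuous f /\
  exists g : Y -> X, [/\ continuous g, cancel f g & cancel g f].

Definition separable_space (T : topologicalType) : Prop :=
  exists2 D : set T, countable D & dense D.

Definition metrizable (R : realType) (T : topologicalType) : Prop :=
  exists (M : metricType R) (f : T -> M), homeomorphism f.

(* The library's algebra structures cannot be joined with its normed modules
   (their only common extension is numDomainType), hence a product of our own.
   The zero algebra is not excluded here, but carries no non-trivial flow. *)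
HB.mixin Record isUnitalCStarAlgebra (R : realType) A
    & CompleteNormedModule R[i] A := {
  cmul : A -> A -> A ;
  cone : A ;
  star : A -> A ;
  cmulA : associative cmul ;
  cmul1l : left_id cone cmul ;
  cmul1r : right_id cone cmul ;
  cmulDl : left_distributive cmul +%R ;
  cmulDr : right_distributive cmul +%R ;
  cmulZl : forall (c : R[i]) (x y : A), cmul (c *: x) y = c *: cmul x y ;
  cmulZr : forall (c : R[i]) (x y : A), cmul x (c *: y) = c *: cmul x y ;
  starK : involutive star ;
  starD : {morph star : x y / x + y} ;
  starZ : forall (c : R[i]) (x : A), star (c *: x) = c^* *: star x ;
  starM : forall x y, star (cmul x y) = cmul (star y) (star x) ;
  cnormM : forall x y : A, `|cmul x y| <= `|x| * `|y| ;
  cnorm_star : forall x : A, `|cmul (star x) x| = `|x| ^+ 2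
}.

#[short(type="unitalCStarAlgType")]
HB.structure Definition UnitalCStarAlgebra (R : realType) :=
  {A of CompleteNormedModule R[i] A & isUnitalCStarAlgebra R A}.

Notation "x ** y" := (cmul x y) (at level 40, left associativity).

Section CStarAlgebras.
Variables (R : realType) (A : unitalCStarAlgType R).

Definition star_automorphism (f : A -> A) : Prop :=
  [/\ bijective f, linear f, {morph f : x y / x ** y}
    & {morph f : x / star x}].

Definition is_flow (sigma : R -> A -> A) : Prop :=
  [/\ forall t, star_automorphism (sigma t),
      forall a, sigma 0 a = a,
      forall s t a, sigma (s + t) a = sigma s (sigma t a)
    & forall a, continuous (sigma ^~ a)].

Definition closed_ideal (I : set A) : Prop :=
  [/\ I 0,
      forall x y, I x -> I y -> I (x + y),
      forall (c : R[i]) x, I x -> I (c *: x),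
      forall a x, I x -> I (a ** x) /\ I (x ** a)
    & closed I].

Definition flow_invariant (sigma : R -> A -> A) (I : set A) : Prop :=
  forall t, sigma t @` I `<=` I.

Definition simple_flow (sigma : R -> A -> A) : Prop :=
  [/\ separable_space A, is_flow sigma,
      ~ (forall t a, sigma t a = a)
    & forall I : set A, closed_ideal I -> flow_invariant sigma I ->
        I = [set 0] \/ I = setT].

(* [F z] is sigma_z(a); an entire function is determined by its restriction
   to the real line, so that [F] is unique when it exists. *)
Definition analytic_extension (sigma : R -> A -> A) (a : A)
    (F : R[i]^o -> A) : Prop :=
  (forall z, derivable F z 1) /\ (forall t : R, F t%:C = sigma t a).

(* Positive linear functionals of norm 1: the last two conditions say that 1 is
   the least c such that |w a| <= c |a| for all a. *)
Definition is_state (w : A -> R[i]^o) : Prop :=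
  [/\ linear w,
      forall a, 0 <= w (star a ** a),
      forall a, `|w a| <= `|a|
    & forall c : R, (forall a, `|w a| <= c%:C * `|a|) -> 1 <= c].

(* As a type, [state_space] carries the subspace topology of the topology of
   pointwise convergence on functions A -> C, i.e. the weak* topology. *)
Definition state_space : set {ptws A -> R[i]^o} :=
  [set w : {ptws A -> R[i]^o} | is_state w].

Definition state_fun (w : state_space) : A -> R[i] := set_val w.

Definition KMS (sigma : R -> A -> A) (beta : R) : set state_space :=
  [set w | (forall t a, state_fun w (sigma t a) = state_fun w a) /\
    forall a b F, analytic_extension sigma a F ->
      state_fun w (a ** b) = state_fun w (b ** F ('i * beta%:C))].

Definition KMS_infty (sigma : R -> A -> A) : set state_space :=
  \bigcap_(r in [set r : R | 0 < r])
    closure (\bigcup_(beta in [set beta : R | r <= beta]) KMS sigma beta).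

Definition KMS_total (sigma : R -> A -> A) : set (state_space * R) :=
  [set x | KMS sigma x.2 x.1].

End CStarAlgebras.

Section ChoquetSimplices.
Variables (R : realType) (E : tvsType R) (K : set E).

Definition base_cone : set (E * R) :=
  [set v | exists (a : R) (x : E), [/\ 0 <= a, K x & v = (a *: x, a)]].

Definition base_span : set (E * R) :=
  [set v | exists u w, [/\ base_cone u, base_cone w & v = u - w]].

(* Choquet's definition: the space spanned by the cone over K x {1} is a lattice
   in the order whose positive cone it is. *)
Definition choquet_simplex : Prop :=
  [/\ compact K, convex_set K
    & forall u v, base_span u -> base_span v ->
        exists w, [/\ base_span w, base_cone (w - u), base_cone (w - v)
          & forall z, base_span z -> base_cone (z - u) -> base_cone (z - v) ->
              base_cone (z - w)]].

End ChoquetSimplices.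

(* The affine structure of the fibres is recorded by [bcomb]: for 0 <= p <= 1 and
   x, y, z in one fibre, [bcomb p x y z] means z = p x + (1 - p) y. *)
Record bundle (R : realType) := Bundle {
  btotal : topologicalType ;
  bproj : btotal -> R ;
  bcomb : R -> btotal -> btotal -> btotal -> Prop
}.

Section SimplexBundles.
Variable R : realType.
Implicit Types B : bundle R.

Definition fibre B (t : R) : set (btotal B) := @bproj R B @^-1` [set t].

Definition simplex_fibre B (t : R) : Prop :=
  exists (E : tvsType R) (K : set E) (h : @fibre B t -> K),
    [/\ hausdorff_space E, choquet_simplex K, homeomorphism h
      & forall (p : R) x y z, 0 <= p <= 1 ->
          bcomb p (set_val x) (set_val y) (set_val z) <->
          set_val (h z) = p *: set_val (h x) + (1 - p) *: set_val (h y) :> E].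

Definition simplex_bundle B : Prop :=
  [/\ @second_countable (btotal B), locally_compact [set: btotal B],
      hausdorff_space (btotal B), continuous (@bproj R B)
    & forall t, simplex_fibre B t].

Definition fibrewise_affine B : set (btotal B -> R) :=
  [set f | continuous f /\
    forall (t p : R) x y z, 0 <= p <= 1 ->
      fibre t x -> fibre t y -> fibre t z -> bcomb p x y z ->
      f z = p * f x + (1 - p) * f y].

Definition proper_simplex_bundle B : Prop :=
  [/\ simplex_bundle B,
      forall K : set R, compact K -> compact (@bproj R B @^-1` K)
    & forall x y : btotal B, x <> y ->
        exists2 f, fibrewise_affine f & f x <> f y].

Definition bundle_isomorphism B B' (phi : btotal B -> btotal B') : Prop :=
  [/\ homeomorphism phi, forall x, bproj (phi x) = bproj x
    & forall (t p : R) x y z, 0 <= p <= 1 ->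
        fibre t x -> fibre t y -> fibre t z -> bcomb p x y z ->
        bcomb p (phi x) (phi y) (phi z)].

Definition isomorphic_bundles B B' : Prop :=
  exists phi : btotal B -> btotal B', bundle_isomorphism phi.

Definition KMS_bundle (A : unitalCStarAlgType R) (sigma : R -> A -> A)
    : bundle R :=
  @Bundle R (KMS_total sigma) (fun x => (set_val x).2)
    (fun p x y z => forall a, state_fun (set_val z).1 a =
       p%:C * state_fun (set_val x).1 a +
       (1 - p)%:C * state_fun (set_val y).1 a).

End SimplexBundles.

(* Main.v *)
Require Import Defs.
From HB Require Import structures.
From mathcomp Require Import all_boot all_order all_algebra.
From mathcomp Require Import complex ring lra.
From mathcomp Require Import all_classical all_reals all_analysis.

(* Compactness and metrizability come from the state space: for positive
   contractive functionals, norm 1 is equivalent to w(1) = 1, so the states form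
   a closed subset of a product of discs, and since A is separable they are
   separated by countably many continuous functions.
   Connectedness: over [r, oo[ the projection of the KMS bundle is a proper map
   with non-empty convex, hence connected, fibres, so the preimage of [r, oo[ is
   connected, and so is its image, the union of the S_beta over beta >= r.
   KMS_infty is a decreasing intersection of the closures of these unions in a
   compact Hausdorff space, hence connected. *)

Import Order.TTheory GRing.Theory Num.Theory.
Import numFieldNormedType.Exports.

Local Open Scope classical_set_scope.
Local Open Scope ring_scope.

(** * Topology of the complex numbers *)

Lemma Re_continuous (R : realType) :
  continuous (fun z : R[i]^o => complex.Re z : R^o).
Proof.
move=> z; apply/(@cvgrPdist_lt _ R^o _ _ (nbhs_filter (z : R[i]^o))) => e e0.
have e0' : 0 < (e%:C)%C by rewrite ltcR.
have := @cvgr_dist_lt _ _ _ _ (nbhs_filter (z : R[i]^o)) id z cvg_id _ e0'.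
apply: filterS => y /= zye; rewrite -ltcR; apply: le_lt_trans zye.
by apply: le_trans (normc_ge_Re _); case: z y => [? ?] [? ?].
Qed.

Lemma Im_continuous (R : realType) :
  continuous (fun z : R[i]^o => complex.Im z : R^o).
Proof.
have -> : (fun z : R[i]^o => complex.Im z : R^o) =
    (fun z : R[i]^o => complex.Re z : R^o) \o
    (fun z : R[i]^o => (- 'i%C : R[i]) *: z).
  by apply/funext => -[x y]; rewrite /GRing.scale /=; simpc.
move=> z; apply: continuous_comp; last exact: Re_continuous.
exact: scaler_continuous.
Qed.

Lemma complex_continuous (R : realType) :
  continuous (fun p : R * R => (p.1 +i* p.2)%C : R[i]^o).
Proof.
move=> p; apply/(@cvgrPdist_lt _ R[i]^o) => -[e e'] /=.
(* A positive element of [R[i]] has imaginary part 0, so the radius is a real number [e]. *)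
rewrite ltcE/= => /andP[/eqP -> e0].
have e20 : 0 < e / 2 by rewrite divr_gt0.
near=> q.
have -> : ((p.1 +i* p.2) - (q.1 +i* q.2) =
    ((p.1 - q.1) +i* 0) + (0 +i* (p.2 - q.2)))%C by simpc.
apply: (le_lt_trans (ler_normD _ _)).
rewrite !normc_def /= expr0n /= addr0 add0r !sqrtr_sqr.
rewrite -[(e +i* 0)%C]/(e%:C)%C -rmorphD /= ltcR (splitr e) ltrD//.
- near: q.
  by apply: (@cvgr_dist_lt _ R^o _ (nbhs p) _ fst p.1) => //; exact: cvg_fst.
- near: q.
  by apply: (@cvgr_dist_lt _ R^o _ (nbhs p) _ snd p.2) => //; exact: cvg_snd.
Unshelve. all: by end_near. Qed.

Lemma closed_nonneg_complex (R : realType) : closed [set z : R[i]^o | 0 <= z].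
Proof.
have -> : [set z : R[i]^o | 0 <= z] =
    [set z : R[i]^o | 0 <= complex.Re z] `&`
    [set z : R[i]^o | complex.Im z = 0].
  apply/seteqP; split => z /=; rewrite lecE /=.
    by move=> /andP[/eqP ->].
  by move=> [-> ->]; rewrite eqxx.
apply: closedI.
  by apply: preimage_closed (@closed_ge R 0) => z _; exact: Re_continuous.
by apply: preimage_closed (@closed_eq R 0) => z _; exact: Im_continuous.
Qed.

Lemma closed_disc_complex (R : realType) (r : R[i]) :
  closed [set z : R[i]^o | `|z| <= r].
Proof.
have -> : [set z : R[i]^o | `|z| <= r] =
    (fun z : R[i]^o => r - `|z|) @^-1` [set z : R[i]^o | 0 <= z].
  by apply/seteqP; split => z /=; rewrite subr_ge0.
apply: preimage_closed (@closed_nonneg_complex R) => z _.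
apply: (@continuousB _ R[i]^o); first exact: cst_continuous.
exact: (@norm_continuous _ R[i]^o).
Qed.

(** The disc is a closed subset of the image of a compact square: a modulus below [r] is at most the
    real part of [r], and so are both coordinates in absolute value. *)
Lemma compact_disc_complex (R : realType) (r : R[i]) :
  compact [set z : R[i]^o | `|z| <= r].
Proof.
pose b := complex.Re r.
apply: (@subclosed_compact _ _
  ((fun p : R * R => (p.1 +i* p.2)%C : R[i]^o) @` (`[-b, b] `*` `[-b, b]))).
- exact: closed_disc_complex.
- apply: continuous_compact.
    by apply: continuous_subspaceT; exact: complex_continuous.
  by apply: compact_setX; exact: segment_compact.
- move=> z /=; rewrite normc_def lecE /= => /andP[_ zb].
  exists (complex.Re z, complex.Im z); last by case: z zb.
  have b2 u v : Num.sqrt (u ^+ 2 + v ^+ 2) <= b -> `|u| <= b.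
    apply: le_trans; rewrite -sqrtr_sqr ler_wsqrtr//.
    by rewrite lerDl sqr_ge0.
  split; rewrite /= in_itv /= -ler_norml.
    exact: b2 zb.
  by apply: (b2 _ (complex.Re z)); rewrite addrC.
Qed.

(** * States *)

Section States.
Variables (R : realType) (A : unitalCStarAlgType R).
Implicit Types (w : A -> R[i]^o) (a b : A).

Lemma star1 : star (cone : A) = cone.
Proof. by rewrite -[LHS]cmul1l -{1}(starK (cone : A)) -starM cmul1l starK. Qed.

(** The C*-identity at 1 makes the norm of 1 equal to its own square, hence 0 or 1; the value 0
    occurs in the zero algebra. *)
Lemma cnorm1_le1 : `|cone : A| <= 1.
Proof.
have := cnorm_star (cone : A); rewrite star1 cmul1l => e.
have [-> //|n0] := eqVneq `|cone : A| 0.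
rewrite -(ler_pM2l (x := `|cone : A|)) ?lt_def ?n0 ?normr_ge0//.
by rewrite mulr1 -expr2 -e.
Qed.

Lemma linear_funD w a b : linear w -> w (a + b) = w a + w b.
Proof. by move=> lw; rewrite -[a in LHS]scale1r lw scale1r. Qed.

Lemma linear_funZ w (k : R[i]) a : linear w -> w (k *: a) = k * w a.
Proof.
move=> lw; have w0 : w 0 = 0.
  by apply: (addrI (w 0)); rewrite addr0 -linear_funD// addr0.
by rewrite -[k *: a]addr0 lw w0 addr0.
Qed.

Lemma linear_funB w a b : linear w -> w (a - b) = w a - w b.
Proof. by move=> lw; rewrite linear_funD// -scaleN1r linear_funZ// mulN1r. Qed.

(** Used at t = 1 and t = i to show that [w] is hermitian, and at t = - w(a) for the bound behind
    w(1) = 1. *)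
Lemma linear_fun_quadratic w a (t : R[i]) : linear w ->
  w (star (t *: cone + a) ** (t *: cone + a)) =
  t^*%C * t * w cone + t^*%C * w a + t * w (star a) + w (star a ** a).
Proof.
move=> lw; rewrite starD starZ star1 cmulDl !cmulDr !cmulZl !cmulZr.
rewrite !cmul1l cmul1r !linear_funD// !linear_funZ//.
by rewrite !addrA -!mulrA.
Qed.

(** Polarization: the quadratic form of [w] is real at 1 + a and at i + a. The first fact determines
    the imaginary part of [w (star a)], the second its real part. *)
Lemma positive_star w a : linear w -> (forall b, 0 <= w (star b ** b)) ->
  w (star a) = (w a)^*%C.
Proof.
move=> lw pw.
have w1 : 0 <= w cone by rewrite -[cone]cmul1l -{1}star1.
have wa := pw a.
have := pw (1 *: cone + a); have := pw ('i%C *: cone + a).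
rewrite !linear_fun_quadratic//.
move: w1 wa; rewrite !lecE.
case: (w cone) => c c'; case: (w a) => x y; case: (w (star a)) => x' y'.
case: (w _) => d d' /=; simpc.
move=> /andP[/eqP c0 _] /andP[/eqP d0 _] /andP[/eqP e1 _] /andP[/eqP e2 _].
congr (_ +i* _)%C; lra.
Qed.

Lemma state_unit w : is_state w -> w cone = 1.
Proof.
case=> lw pw bw nw.
have w1 : 0 <= w cone by rewrite -[cone]cmul1l -{1}star1.
have w1E : w cone = (complex.Re (w cone))%:C%C.
  by move: w1; rewrite lecE; case: (w cone) => ? ? /= /andP[/eqP -> _].
set q := complex.Re (w cone) in w1E.
have q1 : q <= 1.
  have := le_trans (bw cone) cnorm1_le1.
  rewrite w1E normc_def /= expr0n addr0 sqrtr_sqr lecR.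
  exact: le_trans (ler_norm _).
(* Expand 0 <= w ((a - w(a) 1)^* (a - w(a) 1)); not dividing by q = w(1), as
   Cauchy-Schwarz would, avoids the case q = 0. *)
have wsq a : `|w a| ^+ 2 * (2 - q)%:C%C <= `|a| ^+ 2.
  have pa : w (star a ** a) <= `|a| ^+ 2.
    by rewrite -cnorm_star -[leLHS]ger0_norm// bw.
  rewrite -subr_ge0; apply: le_trans (lerB pa (lexx _)).
  have := pw (- w a *: cone + a).
  rewrite linear_fun_quadratic// positive_star// w1E rmorphN sqr_normc.
  congr (0 <= _); rewrite rmorphB /= rmorph_nat.
  by ring.
have s0 : 0 < 2 - q by lra.
(* By [wsq], the number (2 - q)^(-1/2) bounds [w]. Since 1 is the least bound, that number is at
   least 1, and with q <= 1 this forces q = 1. *)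
suff : 1 <= (2 - q)^-1.
  by rewrite invf_ge1// => q2; rewrite w1E; congr (_ +i* _)%C; lra.
have s2 : Num.sqrt (2 - q)^-1 ^+ 2 = (2 - q)^-1.
  by rewrite sqr_sqrtr ?invr_ge0 ?(ltW s0).
have s_ge0 := sqrtr_ge0 (2 - q)^-1.
set s := Num.sqrt _ in s2 s_ge0; rewrite -s2.
apply: exprn_ege1; apply: nw => a.
rewrite -(@ler_pXn2r _ 2%N) ?nnegrE ?normr_ge0 ?mulr_ge0 ?lecR//.
have -> : (s%:C%C * `|a|) ^+ 2 = `|a| ^+ 2 / (2 - q)%:C%C.
  rewrite exprMn mulrC -(fmorphV (real_complex R)) /= -s2.
  by rewrite (rmorphXn (real_complex R)).
by rewrite ler_pdivlMr ?ltcR.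
Qed.

(** Trades the condition on all bounds c for one equation at [cone], which is visibly closed in the
    weak* topology. Conversely, testing a bound c at 1 gives 1 <= c |1| with |1| <= 1, and a
    negative c would make the right side nonpositive. *)
Lemma is_stateP w : is_state w <->
  [/\ linear w, forall a, 0 <= w (star a ** a),
      forall a, `|w a| <= `|a| & w cone = 1].
Proof.
split=> [sw|[lw pw bw w1]]; first by rewrite state_unit//; case: sw.
split=> // c /(_ cone); rewrite w1 normr1 => c1.
rewrite -lecR (le_trans c1)//.
have [c0|c0] := leP 0 c.
  by rewrite ler_piMr ?lecR// cnorm1_le1.
have c0' : c%:C%C * `|cone : A| <= 0.
  by rewrite mulr_le0_ge0// lecR ltW.
by have := le_trans c1 c0'; rewrite ler10.
Qed.
End States.

(** * Topology of the state space *)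

Lemma set_val_continuous (X : topologicalType) (K : set X) :
  continuous (set_val : K -> X).
Proof. exact: initial_continuous. Qed.

Lemma compact_set_type (X : topologicalType) (K : set X) :
  compact K -> compact [set: K].
Proof.
move=> cK F FF _.
have [|p [Kp clp]] := cK (set_val @ F) _.
  by apply: (@filterS _ F _ setT) => [x _|]; [exact: set_valP|exact: filterT].
exists (SigSub (mem_set Kp)); split => // U V FU.
rewrite nbhsE => -[_ [[W oW <-] Wp] WV].
have FU' : (set_val @ F) (set_val @` U).
  by apply: (@filterS _ F _ U) => // x Ux; exists x.
have [_ [[x Ux <-] Wx]] := clp _ _ FU' (open_nbhs_nbhs (conj oW Wp)).
by exists x; split => //; exact: WV.
Qed.

Lemma hausdorff_set_type (X : topologicalType) (K : set X) :
  hausdorff_space X -> hausdorff_space K.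
Proof.
move=> hX x y clxy; apply: val_inj; apply: hX => U V xU yV.
have [||z [Uz Vz]] := clxy (set_val @^-1` U) (set_val @^-1` V).
- exact: set_val_continuous.
- exact: set_val_continuous.
by exists (set_val z).
Qed.

Section StateSpace.
Variables (R : realType) (A : unitalCStarAlgType R).

Lemma eval_continuous (a : A) : continuous (fun w : {ptws A -> R[i]^o} => w a).
Proof. exact: (@proj_continuous _ (fun=> R[i]^o) a). Qed.

Lemma state_fun_continuous (a : A) :
  continuous (fun w : @state_space R A => state_fun w a : R[i]^o).
Proof.
move=> w; apply: (@continuous_comp _ _ _ set_val
    (fun w : {ptws A -> R[i]^o} => w a)).
  exact: set_val_continuous.
exact: eval_continuous.
Qed.

Lemma closed_state_space : closed (@state_space R A).
Proof.
(* By [is_stateP] each clause is a closed condition on finitely many evaluations; [k] packs the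
   scalar and the two vectors of the linearity identity. *)
have -> : @state_space R A =
    \bigcap_(k in [set: R[i] * A * A])
      [set w : {ptws A -> R[i]^o} |
        w (k.1.1 *: k.1.2 + k.2) - (k.1.1 *: w k.1.2 + w k.2) = 0]
    `&` \bigcap_(a in [set: A])
      [set w : {ptws A -> R[i]^o} | 0 <= w (star a ** a)]
    `&` \bigcap_(a in [set: A])
      [set w : {ptws A -> R[i]^o} | `|w a| <= `|a|]
    `&` [set w : {ptws A -> R[i]^o} | w cone = 1].
  apply/seteqP; split => w.
    move=> /is_stateP[lw pw bw w1]; split=> //.
    split=> [|a _]; last exact: bw.
    split=> [|a _]; last exact: pw.
    by move=> [[k a] b] _ /=; rewrite lw subrr.
  move=> [[[lw pw] bw] w1]; apply/is_stateP; split => //.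
  - move=> k a b; apply/eqP; rewrite -subr_eq0; apply/eqP.
    exact: (lw (k, a, b) I).
  - by move=> a; exact: (pw a I).
  - by move=> a; exact: (bw a I).
have cl1 (x : R[i]^o) : closed [set x].
  by apply: accessible_closed_set1; exact: hausdorff_accessible.
pose ev (a : A) (w : {ptws A -> R[i]^o}) := w a.
apply: closedI; first apply: closedI; first apply: closedI.
- apply: closed_bigI => -[[k a] b] _.
  apply: preimage_closed (cl1 0) => w _ /=.
  apply: (@continuousB _ R[i]^o _ (ev (k *: a + b))
    ((fun z : R[i]^o => k *: z) \o ev a + ev b)).
    exact: eval_continuous.
  apply: (@continuousD _ R[i]^o _ _ (ev b)); last exact: eval_continuous.
  apply: continuous_comp; first exact: eval_continuous.
  exact: scaler_continuous.
- apply: closed_bigI => a _.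
  apply: preimage_closed (@closed_nonneg_complex R) => w _.
  exact: eval_continuous.
- apply: closed_bigI => a _.
  apply: preimage_closed (@closed_disc_complex R `|a|) => w _.
  exact: eval_continuous.
- by apply: preimage_closed (cl1 1) => w _; exact: eval_continuous.
Qed.

(** The Banach-Alaoglu argument: states lie in the product of the discs of radius |a|, which is
    compact by Tychonoff. *)
Lemma compact_state_space : compact [set: @state_space R A].
Proof.
apply: compact_set_type; apply: subclosed_compact closed_state_space _ _.
  apply: (@tychonoff A (fun=> R[i]^o)
    (fun a => [set z : R[i]^o | `|z| <= `|a|])).
  by move=> a; exact: compact_disc_complex.
by move=> w [_ _ bw _].
Qed.

Lemma hausdorff_state_space : hausdorff_space (@state_space R A).
Proof.
apply: hausdorff_set_type; apply: hausdorff_product => a; exact: norm_hausdorff.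
Qed.

End StateSpace.

(** * Metrizability *)

(** A copy of [T] that remembers [f] and the separation proof, so that it can carry the metric while
    [T] keeps its own topology. *)
Definition sequence_metric (R : realType) (T : topologicalType)
    (f : nat -> T -> R)
  of (forall x y, (forall n, f n x = f n y) -> x = y) : Type := T.

Section SequenceMetric.
Variables (R : realType) (T : topologicalType) (f : nat -> T -> R).
Hypothesis sep : forall x y, (forall n, f n x = f n y) -> x = y.

(** The cap 1/(n+1) makes late coordinates uniformly small, so that up to any given error only
    finitely many [f n] matter in the supremum. *)
Definition truncated_diff (x y : T) (n : nat) : R :=
  Num.min `|f n x - f n y| n.+1%:R^-1.

Definition sequence_dist (x y : T) : R := sup (range (truncated_diff x y)).

Lemma truncated_diff_has_sup x y : has_sup (range (truncated_diff x y)).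
Proof.
split; first by exists (truncated_diff x y 0), 0%N.
exists 1 => _ [n _ <-]; rewrite ge_min; apply/orP; right.
by rewrite invf_le1// ler1n.
Qed.

Lemma truncated_diff_le_dist x y n : truncated_diff x y n <= sequence_dist x y.
Proof. by apply: ub_le_sup; [case: (truncated_diff_has_sup x y)|exists n]. Qed.

Lemma sequence_dist_le x y (e : R) :
  (forall n, truncated_diff x y n <= e) -> sequence_dist x y <= e.
Proof.
move=> le_e; apply: ge_sup; last by move=> _ [n _ <-].
by case: (truncated_diff_has_sup x y).
Qed.

Lemma sequence_distxx x : sequence_dist x x = 0.
Proof.
apply/le_anti/andP; split.
  by apply: sequence_dist_le => n; rewrite ge_min subrr normr0 lexx.
apply: le_trans (truncated_diff_le_dist x x 0).
by rewrite le_min normr_ge0 /= invr_ge0 ler0n.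
Qed.

Lemma sequence_dist_eq0 x y : sequence_dist x y = 0 -> x = y.
Proof.
move=> d0; apply: sep => n; apply/eqP; rewrite -subr_eq0 -normr_le0.
have := truncated_diff_le_dist x y n; rewrite d0 ge_min => /orP[//|].
by rewrite leNgt invr_gt0 ltr0n.
Qed.

Lemma sequence_dist_sym x y : sequence_dist x y = sequence_dist y x.
Proof.
rewrite /sequence_dist (_ : truncated_diff x y = truncated_diff y x)//.
by apply/funext => n; rewrite /truncated_diff distrC.
Qed.

Lemma sequence_dist_triangle y x z :
  sequence_dist x z <= sequence_dist x y + sequence_dist y z.
Proof.
apply: sequence_dist_le => n.
apply: le_trans (lerD (truncated_diff_le_dist x y n)
  (truncated_diff_le_dist y z n)).
rewrite /truncated_diff; have := ler_distD (f n y) (f n x) (f n z).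
have c0 : 0 <= n.+1%:R^-1 :> R by rewrite invr_ge0.
have := normr_ge0 (f n x - f n y); have := normr_ge0 (f n y - f n z).
(* What is left is that truncation at a constant c >= 0 is monotone and subadditive on nonnegative
   reals. *)
move: `|_| `|_| `|_| (n.+1%:R^-1) c0 => a b d c c0.
by rewrite !minElt => *; do 3 (case: ltP => ?); lra.
Qed.

HB.instance Definition _ := Choice.copy (@sequence_metric R T f sep) T.
HB.instance Definition _ := isMetric.Build R (@sequence_metric R T f sep)
  sequence_distxx sequence_dist_eq0 sequence_dist_sym sequence_dist_triangle.

Lemma sequence_metric_continuous :
  (forall n, continuous (f n : T -> R^o)) ->
  continuous (id : T -> @sequence_metric R T f sep).
Proof.
move=> cf x; apply/metricType_numDomainType.cvgrPdist_lt => e e0.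
have e20 : 0 < e / 2 by rewrite divr_gt0.
(* From index [N] on the cap is at most e / 2, so only the first [N] coordinates need control near
   [x]. Halving e leaves room because a supremum preserves only the weak inequality. *)
pose N := Num.truncn (e / 2)^-1.
have Ne n : (N <= n)%N -> n.+1%:R^-1 <= e / 2.
  move=> Nn; rewrite invf_ple ?posrE// ltW// (lt_le_trans (truncnS_gt _))//.
  by rewrite ler_nat.
have : \forall y \near x, forall n : 'I_N, `|f n x - f n y| < e / 2.
  apply: filter_forall => n.
  exact: (@cvgr_dist_lt _ R^o _ _ _ (f n) _ (cf n x)).
apply: filterS => y fxy /=.
apply: (@le_lt_trans _ _ (e / 2)); last first.
  by rewrite ltr_pdivrMr// ltr_pMr// ltr1n.
apply: sequence_dist_le => n; rewrite ge_min.
have [nN|Nn] := ltnP n N; first by rewrite (ltW (fxy (Ordinal nN))).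
by rewrite Ne ?orbT.
Qed.

End SequenceMetric.

Lemma compact_bijection_homeomorphism (X Y : topologicalType) (f : X -> Y)
    (g : Y -> X) :
  compact [set: X] -> hausdorff_space Y -> continuous f ->
  cancel f g -> cancel g f -> homeomorphism f.
Proof.
move=> cX hY cf fK gK; split => //; exists g; split => //.
apply/continuous_closedP => C cC.
have -> : g @^-1` C = f @` C.
  apply/seteqP; split => [y Cy|_ [x Cx <-]]; first by exists (g y).
  by rewrite /preimage /= fK.
apply: compact_closed => //; apply: continuous_compact.
  exact: continuous_subspaceT.
exact: subclosed_compact cX _.
Qed.

(** The identity onto the metric copy of [T] is a continuous bijection from a compact to a Hausdorff
    space. *)
Lemma compact_metrizable (R : realType) (T : topologicalType)
    (f : nat -> T -> R) :
  compact [set: T] -> (forall n, continuous (f n : T -> R^o)) ->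
  (forall x y, (forall n, f n x = f n y) -> x = y) -> metrizable R T.
Proof.
move=> cT cf sep; exists (@sequence_metric R T f sep), id.
apply: (@compact_bijection_homeomorphism T (@sequence_metric R T f sep) id id)
  => //.
  exact: metric_hausdorff.
exact: (@sequence_metric_continuous R T f sep).
Qed.

(** * Connectedness *)

(** A non-empty convex set is the union of its segments from a base point [x0]; each is a continuous
    image of [0, 1], and all contain [x0]. *)
Lemma convex_connected (R : realType) (E : tvsType R) (K : set E) :
  convex_set K -> connected K.
Proof.
move=> cK; have [->|/set0P[x0 Kx0]] := eqVneq K set0; first exact: connected0.
pose seg x (t : R) : E := t *: x + (1 - t) *: x0.
have seg_cont x : continuous (seg x : R^o -> E).
  have scal (s : R^o -> R^o) (y : E) :
      continuous s -> continuous (fun t => s t *: y).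
    move=> cs t; apply: (@continuous_comp _ (R^o * E)%type _
      (fun t => (s t, y)) (fun z => z.1 *: z.2)); last exact: scale_continuous.
    by apply: (cvg_pair (cs t)); exact: (@cvg_cst E).
  move=> t; apply: (@continuous_comp R^o (E * E)%type E
    (fun t => (t *: x, (1 - t) *: x0)) (fun z => z.1 + z.2)).
    apply: (cvg_pair (scal id x _ t)) => [?|]; first exact: cvg_id.
    apply: (scal (fun t => 1 - t)) => ?.
    by apply: (@continuousB _ R^o); [exact: cst_continuous|exact: cvg_id].
  exact: add_continuous.
have -> : K = \bigcup_(x in K) (seg x @` `[0, 1]).
  apply/seteqP; split => [x Kx|_ [x Kx [t t01 <-]]].
    exists x => //; exists 1; first by rewrite /= in_itv /= lexx ler01.
    by rewrite /seg subrr scale0r addr0 scale1r.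
  move: t01; rewrite /= in_itv /= => /andP[t0 t1].
  have := cK x x0 (Itv01 t0 t1) (mem_set Kx) (mem_set Kx0).
  by rewrite inE.
apply: bigcup_connected.
  exists x0 => x Kx; exists 0; first by rewrite /= in_itv /= lexx ler01.
  by rewrite /seg scale0r add0r subr0 scale1r.
move=> x Kx; apply: connected_continuous_connected.
  exact/connected_intervalP/interval_is_interval.
exact: continuous_subspaceT.
Qed.

Lemma simplex_fibre_connected (R : realType) (B : bundle R) (t : R) :
  simplex_fibre B t -> connected (fibre (B := B) t).
Proof.
move=> [E [K [h [_ [_ cK _] [_ [g [cg hK gK]]] _]]]].
have [->|/set0P[y0 y0t]] := eqVneq (fibre (B := B) t) set0.
  exact: connected0.
pose f : K -> btotal B := set_val \o g.
have cf : continuous f.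
  by move=> x; apply: continuous_comp; [exact: cg|exact: set_val_continuous].
(* [g] lives on the subtype of [K]; [valL_ y0] extends [f] to all of [E] with default value [y0]
   outside [K], so that connectedness of [K] as a subset of [E] applies. *)
have -> : fibre (B := B) t = valL_ y0 f @` K.
  apply/seteqP; split => [y yt|_ [x Kx <-]].
    pose y' : fibre (B := B) t := SigSub (mem_set yt).
    exists (set_val (h y')); first exact: set_valP.
    have := congr1 (fun F => F (h y')) (valLK y0 f).
    by rewrite /sigL /= => ->; rewrite /f /= hK.
  have := congr1 (fun F => F (SigSub (mem_set Kx))) (valLK y0 f).
  by rewrite /sigL /= => ->; exact: set_valP.
apply: connected_continuous_connected; first exact: convex_connected.
exact/subspace_valL_continuousP'.
Qed.

(** A limit point of [C] stays in the closed union, and separation keeps it out of [D]. This makes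
    both halves of a disconnection of a closed set closed. *)
Lemma separated_closed (X : topologicalType) (C D : set X) :
  separated C D -> closed (C `|` D) -> closed C.
Proof.
move=> [clCD _] clU; rewrite closure_id; apply/seteqP.
split=> [|x clx]; first exact: subset_closure.
have : (C `|` D) x.
  by move/closure_id : clU => ->; apply: closureS clx; exact: subsetUl.
case=> // Dx; exfalso; have : (closure C `&` D) x by [].
by rewrite clCD.
Qed.

(** A disconnection would have compact halves, whose images are closed and cover the segment. Each
    connected fibre lies in one half, so the images are disjoint, contradicting connectedness of the
    segment. *)
Lemma connected_preimage_segment (R : realType) (X : topologicalType)
    (p : X -> R) (a b : R) :
  continuous (p : X -> R^o) -> compact (p @^-1` `[a, b]) ->
  (forall t, connected (p @^-1` [set t])) -> `[a, b] `<=` range p ->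
  connected (p @^-1` `[a, b]).
Proof.
move=> cp cpt cfib prange; apply/connectedP => E [E0 EU sE].
have clI : closed (p @^-1` `[a, b]).
  by apply: preimage_closed => [x _|]; [exact: cp|exact: interval_closed].
have clE c : closed (E c).
  rewrite EU in clI; case: c; last exact: separated_closed sE clI.
  by rewrite setUC in clI; apply: separated_closed clI; rewrite separatedC.
have Esub c : E c `<=` p @^-1` `[a, b].
  by rewrite EU; case: c; [exact: subsetUr|exact: subsetUl].
have compE c : compact (E c) by apply: (subclosed_compact _ cpt (Esub c)).
have clpE c : closed (p @` E c : set R^o).
  apply: compact_closed; first exact: norm_hausdorff.
  by apply: continuous_compact (compE c); exact: continuous_subspaceT.
have fibE t : ~ ((p @` E false) t /\ (p @` E true) t).
  move=> [[x Ex xt] [y Ey yt]].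
  (* [t] is the image of a point of a half, so it lies in the segment and its whole fibre is covered
     by the two halves. *)
  have fsub : p @^-1` [set t] `&` p @^-1` `[a, b] = p @^-1` [set t].
    apply/setIidPl => z; rewrite /preimage /= => ->; rewrite -xt.
    exact: (Esub false).
  have ft : p @^-1` [set t] `<=` E false `|` E true.
    by rewrite -EU; exact/setIidPl.
  have dis := separated_disjoint sE.
  have [sub|sub] := connected_subset sE ft (cfib t).
    by have : (E false `&` E true) y; [split => //; exact: sub|rewrite dis].
  by have : (E false `&` E true) x; [split => //; exact: sub|rewrite dis].
have /connectedP/(_ (fun c => p @` E c)) : connected (`[a, b]%classic : set R).
  exact/connected_intervalP/interval_is_interval.
apply; split.
- by move=> c; have [x Ex] := E0 c; exists (p x), x.
- apply/seteqP; split => [t tab|t].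
    have [x _ xt] := prange _ tab.
    have : (p @^-1` `[a, b]) x by rewrite /preimage /= xt.
    by rewrite EU => -[]; [left|right]; exists x.
  by case=> -[x Ex <-]; [exact: (Esub false)|exact: (Esub true)].
- split; apply/seteqP; split => // t [];
    by rewrite -(iffLR (closure_id _) (clpE _)) => ? ?; apply: (fibE t).
Qed.

(** The preimages of the segments [r, b] exhaust that of the half-line and share any point over
    r. *)
Lemma connected_preimage_halfline (R : realType) (X : topologicalType)
    (p : X -> R) (r : R) :
  continuous (p : X -> R^o) -> (forall a b, compact (p @^-1` `[a, b])) ->
  (forall t, connected (p @^-1` [set t])) -> `[r, +oo[ `<=` range p ->
  connected (p @^-1` `[r, +oo[).
Proof.
move=> cp cpt cfib prange.
have -> : p @^-1` `[r, +oo[ = \bigcup_(b in [set b | r <= b]) p @^-1` `[r, b].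
  apply/seteqP; split => [x|x [b _]].
    rewrite /preimage /= in_itv /= andbT => rx; exists (p x) => //.
    by rewrite /preimage /= in_itv /= rx lexx.
  by rewrite /preimage /= !in_itv /= => /andP[-> _].
apply: bigcup_connected.
  have [x _ xr] : range p r by apply: prange; rewrite /= in_itv /= lexx.
  by exists x => b rb; rewrite /preimage /= in_itv /= xr lexx.
move=> b rb; apply: connected_preimage_segment => // t.
by rewrite /= in_itv /= => /andP[rt _]; apply: prange; rewrite /= in_itv /= rt.
Qed.

(** If the intersection split into two closed halves, normality would enclose them in disjoint open
    [U] and [V]. Compactness puts the closure of some [C r] inside their union; being connected, it
    lies in one of them, yet it contains both halves. *)
Lemma connected_bigcap_closure (R : realType) (X : topologicalType)
    (C : R -> set X) (r0 : R) :
  compact [set: X] -> hausdorff_space X ->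
  {homo C : r s / r <= s >-> s `<=` r} ->
  (forall r, r0 <= r -> connected (C r)) ->
  connected (\bigcap_(r in [set r : R | 0 < r]) closure (C r)).
Proof.
move=> cX hX mC cC.
set K := \bigcap_(r in _) _.
have clK : closed K by apply: closed_bigI => r _; exact: closed_closure.
apply/connectedP => E [E0 EU sE].
have Esub c : E c `<=` K.
  by rewrite EU; case: c; [exact: subsetUr|exact: subsetUl].
have clE c : closed (E c).
  rewrite EU in clK; case: c; last exact: separated_closed sE clK.
  by rewrite setUC in clK; apply: separated_closed clK; rewrite separatedC.
have /(@normal_openP R)/(_ _ _ (clE false) (clE true)) := compact_normal hX cX.
move=> /(_ (separated_disjoint sE)) [U [V [oU oV EUf EUt UV0]]].
have [r [r_gt0 rr0 CUV]] :
    exists r, [/\ 0 < r, r0 <= r & closure (C r) `<=` U `|` V].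
  (* Otherwise the sets [D r] are non-empty and decreasing; a cluster point of the filter they
     generate lies in all of them, hence in [K] but outside [U] and [V]. *)
  apply: contrapT => noR.
  pose D r := closure (C r) `\` (U `|` V).
  pose F := filter_from [set r : R | 0 < r /\ r0 <= r] D.
  have FF : ProperFilter F.
    apply: filter_from_proper.
      apply: filter_from_filter.
        exists (Num.max 1 r0); split; first by rewrite lt_max ltr01.
        by rewrite le_max lexx orbT.
      move=> r s [r1 r2] [s1 s2]; exists (Num.max r s).
        by split; [rewrite lt_max r1|rewrite le_max r2].
      move=> x [Cx UVx]; split; split => //; move: Cx; apply: closureS.
        by apply: mC; rewrite le_max lexx.
      by apply: mC; rewrite le_max lexx orbT.
    move=> r [r1 r2]; apply/set0P/negP => /eqP D0; apply: noR.
    by exists r; split => //; rewrite -setD_eq0.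
  have [x [_ clx]] := cX F FF filterT.
  have clD r : closed (D r).
    rewrite /D setDE; apply: closedI; first exact: closed_closure.
    by apply: open_closedC; exact: openU.
  have Dx r : 0 < r -> r0 <= r -> D r x.
    move=> r1 r2; move/closure_id: (clD r) => ->; move: clx; rewrite clusterE.
    by apply; exists r.
  have Kx : K x.
    move=> r /= r1.
    (* Membership in [D] is known only from [r0] on; monotonicity of [C] passes it down to smaller
       indices. *)
    have [] : D (Num.max r r0) x.
      by apply: Dx; [rewrite lt_max r1|rewrite le_max lexx orbT].
    by move=> + _; apply: closureS; apply: mC; rewrite le_max lexx.
  have [] : D (Num.max 1 r0) x.
    by apply: Dx; [rewrite lt_max ltr01|rewrite le_max lexx orbT].
  move=> _; apply; move: Kx; rewrite EU.
  by case; [left; exact: EUf|right; exact: EUt].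
have sUV : separated U V.
  split; apply/seteqP; split => // x [].
    move=> clU Vx; have := clU V (open_nbhs_nbhs (conj oV Vx)).
    by rewrite UV0 => -[].
  move=> Ux clV; have := clV U (open_nbhs_nbhs (conj oU Ux)).
  by rewrite setIC UV0 => -[].
have [x Ex] := E0 false; have [y Ey] := E0 true.
have Cx : closure (C r) x by apply: (Esub false).
have Cy : closure (C r) y by apply: (Esub true).
have [sub|sub] := connected_subset sUV CUV (connected_closure (cC r rr0)).
  by have : (U `&` V) y; [split; [exact: sub|exact: EUt]|rewrite UV0].
by have : (U `&` V) x; [split; [exact: EUf|exact: sub]|rewrite UV0].
Qed.

(** * KMS states *)

Lemma dense_closed_setT (T : topologicalType) (D C : set T) :
  dense D -> closed C -> D `<=` C -> C = setT.
Proof.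
move=> dD clC DC; apply/seteqP; split => // x _; apply: contrapT => nCx.
have [|y [nCy /DC //]] := dD (~` C) _ (closed_openC clC).
by exists x.
Qed.

Section StateDetermination.
Variables (R : realType) (A : unitalCStarAlgType R).

Lemma state_continuous (w : A -> R[i]^o) : is_state w -> continuous w.
Proof.
case=> lw _ bw _ a; apply/(@cvgrPdist_lt _ R[i]^o _ _ (nbhs_filter a)) => e e0.
have := @cvgr_dist_lt _ _ _ _ (nbhs_filter a) id a cvg_id _ e0.
apply: filterS => b /=; apply: le_lt_trans; apply: le_trans (bw _).
by rewrite linear_funB.
Qed.

(** Real parts suffice because the imaginary part of w(a) is minus the real part of w(ia), and
    agreement spreads from [D] by continuity of states. Real-valued functions are what the sequence
    metric takes. *)
Lemma state_eq_dense (D : set A) (w v : @state_space R A) : dense D ->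
  (forall a, D a ->
    complex.Re (state_fun w a) = complex.Re (state_fun v a)) ->
  w = v.
Proof.
move=> dD eqD; apply: val_inj; apply/funext => a.
have sw : is_state (state_fun w) := set_valP w.
have sv : is_state (state_fun v) := set_valP v.
have eqRe b : complex.Re (state_fun w b) = complex.Re (state_fun v b).
  pose diff b : R^o := complex.Re (state_fun w b) - complex.Re (state_fun v b).
  have : closed (diff @^-1` [set 0]).
    apply: preimage_closed => [x _|]; last exact: closed_eq.
    have cRe (u : A -> R[i]^o) : is_state u ->
        continuous (fun b => complex.Re (u b) : R^o).
      move=> su y; apply: continuous_comp; first exact: state_continuous.
      exact: Re_continuous.
    by apply: (@continuousB _ R^o); exact: cRe.
  move=> /(dense_closed_setT _ _ _ dD) diffT.
  apply/eqP; rewrite -subr_eq0; apply/eqP.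
  suff : (diff @^-1` [set 0]) b by [].
  rewrite diffT// => d Dd; rewrite /preimage /= /diff eqD// subrr.
  by [].
have eqIm : complex.Im (state_fun w a) = complex.Im (state_fun v a).
  have := eqRe ('i%C *: a); case: sw sv => [lw _ _ _] [lv _ _ _].
  rewrite !linear_funZ//.
  case: (state_fun w a) (state_fun v a) => [? ?] [? ?].
  by simpc => /= /oppr_inj.
apply/eqP; rewrite eq_complex; apply/andP; split; apply/eqP.
  exact: eqRe.
exact: eqIm.
Qed.

End StateDetermination.

Section KMSInfinity.
Variables (R : realType) (A : unitalCStarAlgType R) (sigma : R -> A -> A).

Lemma compact_KMS_infty : compact (KMS_infty sigma).
Proof.
apply: subclosed_compact (@compact_state_space R A) _ => //.
by apply: closed_bigI => r _; exact: closed_closure.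
Qed.

Lemma metrizable_KMS_infty :
  separable_space A -> metrizable R (KMS_infty sigma).
Proof.
move=> [D /pfcard_geP cD dD].
(* The metric needs a sequence indexed by all of [nat]; the constant 0 serves when [D] is empty. *)
have [e De] : exists e : nat -> A, D `<=` range e.
  case: cD => [D0|[e]]; last by exists e => a /(@surj _ _ _ _ e).
  by exists (fun=> 0) => a; rewrite D0.
apply: (@compact_metrizable R _
  (fun n (x : KMS_infty sigma) => complex.Re (state_fun (set_val x) (e n)))).
- exact: compact_set_type compact_KMS_infty.
- move=> n x; apply: (@continuous_comp _ R[i]^o R^o
    (fun x => state_fun (set_val x) (e n)) (fun z => complex.Re z)).
    apply: (@continuous_comp _ _ _ set_val
      (fun w => state_fun w (e n) : R[i]^o)).
      exact: set_val_continuous.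
    exact: state_fun_continuous.
  exact: Re_continuous.
- move=> x y eqxy; apply: val_inj; apply: state_eq_dense dD _ => _ /De[n _ <-].
  exact: eqxy.
Qed.

End KMSInfinity.

Theorem corollary2p12 (R : realType) (B : bundle R)
    (A : unitalCStarAlgType R) (sigma : R -> A -> A) :
  proper_simplex_bundle B ->
  simple_flow sigma ->
  isomorphic_bundles B (KMS_bundle sigma) ->
  (exists r : R, `[r, +oo[ `<=` range (@bproj R B)) ->
  [/\ connected (KMS_infty sigma),
      compact (KMS_infty sigma)
    & metrizable R (KMS_infty sigma)].
Proof.
move=> [[_ _ _ cproj simplexB] properB _] [sepA _ _ _].
move=> [phi [[cphi [psi [_ _ psiK]]] phiproj _]] [r0 r0range].
split; [|exact: compact_KMS_infty|exact: metrizable_KMS_infty].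
apply: (@connected_bigcap_closure R _ _ r0).
- exact: compact_state_space.
- exact: hausdorff_state_space.
- move=> r s rs w [beta /= sbeta Kw]; exists beta => //=.
  exact: le_trans rs sbeta.
move=> r r0r.
(* [q] sends a point of the bundle to the KMS state it represents. As [phi] is onto and respects the
   projections, the part over [r, oo[ is carried onto the union of the KMS states with beta >= r. *)
pose q (x : btotal B) : @state_space R A := (set_val (phi x)).1.
have -> : \bigcup_(beta in [set beta : R | r <= beta]) KMS sigma beta =
    q @` (@bproj R B @^-1` `[r, +oo[).
  apply/seteqP; split => [w [beta /= rbeta Kw]|_ [x rx <-]].
    pose z : KMS_total sigma :=
      SigSub (mem_set (Kw : KMS_total sigma (w, beta))).
    exists (psi z); last by rewrite /q psiK.
    by rewrite /preimage /= -phiproj psiK /= in_itv /= rbeta.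
  exists (bproj x).
    by move: rx; rewrite /preimage /= in_itv /= andbT.
  by rewrite -phiproj; exact: (set_valP (phi x)).
apply: connected_continuous_connected; last first.
  apply: continuous_subspaceT => x.
  apply: (@continuous_comp _ _ _ phi
    (fun z : KMS_total sigma => (set_val z).1)); first exact: cphi.
  apply: (@continuous_comp _ _ _ set_val fst); last exact: cvg_fst.
  exact: set_val_continuous.
apply: connected_preimage_halfline => //.
- by move=> a b; apply: properB; exact: segment_compact.
- by move=> t; exact: simplex_fibre_connected.
- move=> t; rewrite /= in_itv /= andbT => rt; apply: r0range.
  by rewrite /= in_itv /= andbT (le_trans r0r).
Qed.
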